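(* Let $R$ be an anti-rectangular Abel Grassmann band that is finite or countable, and let $\overline{R}$ be a groupoid anti-isomorphic to $R$. Then $R$ and $\overline{R}$ are isomorphic.
   Context: A groupoid is a nonempty set with a binary operation, written as juxtaposition. An anti-rectangular Abel Grassmann band is a groupoid satisfying $(xy)z=(zy)x$, $x = xx$ and $(xy)x=y$ for all elements $x,y,z$. An anti-isomorphism of groupoids $\Phi:R\to \overline{R}$ is a bijection with $\Phi(xy)=\Phi(y)\Phi(x)$ for all $x,y\in R$; $R$ and $\overline{R}$ are anti-isomorphic if such a $\Phi$ exists. Countable means of cardinality $\aleph_0$. *)

(* Defs.v *)
From HB Require Import structures.
From mathcomp Require Import all_boot.
From mathcomp Require Import all_classical.

Set Implicit Arguments.
Unset Strict Implicit.
Unset Printing Implicit Defensive.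

Local Open Scope group_scope.

(* A groupoid is an inhabited magmaType: magmaType carries a binary operation
   with no axioms, and its carrier may be empty. *)
Definition groupoid (G : magmaType) : Prop := inhabited G.

Definition anti_rectangular_AG_band (G : magmaType) : Prop :=
  [/\ groupoid G,
      forall x y z : G, (x * y) * z = (z * y) * x,
      forall x : G, x = x * x
    & forall x y : G, (x * y) * x = y].

Definition isomorphic (G H : magmaType) : Prop :=
  exists f : {multiplicative G -> H}, bijective f.

Definition anti_isomorphism (G H : magmaType) (f : G -> H) : Prop :=
  bijective f /\ forall x y : G, f (x * y) = f y * f x.

Definition anti_isomorphic (G H : magmaType) : Prop :=
  exists f : G -> H, anti_isomorphism f.

Definition finite_type (T : Type) : Prop := finite_set [set: T].

(* Cardinality exactly aleph_0, unlike the library's [countable], which also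
   admits finite sets. *)
Definition denumerable (T : Type) : Prop := ([set: T] #= [set: nat])%card.

(* Main.v *)
From HB Require Import structures.
Require Import Defs.
From mathcomp Require Import all_boot.
From mathcomp Require Import ssralg.
From mathcomp Require Import all_classical.

(** Anti-rectangular AG-bands are the vector spaces over the field with four
    elements F_4 = {0, 1, w, w^2}, where w^2 = w + 1, under the operation
    x y = w x + w^2 y ([AG_band_affine]).  Multiplication by w is encoded as
    an additive endomorphism w of an abelian group of exponent 2 such that
    w (w x) = w x + x.

    Exchanging w and w^2 turns x y into y x, so it is enough to apply the
    Frobenius automorphism of F_4 to the coordinates in some basis: this is a
    bijection c with c (w x) = w^2 (c x), hence c (x y) = c y c x
    ([frobenius_semilinear_bijection]).  Composing it with an anti-isomorphism
    from R to Rbar gives an isomorphism.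

    All that the construction of c retains of a basis is its F_2-span, a real
    form A of the space: V is the direct sum of A and w A.  A real form is a
    maximal subgroup among those that meet their image under w trivially, so
    Zorn's lemma provides one in any dimension ([real_form_exists]). *)

Import GRing.Theory.

Local Open Scope classical_set_scope.

(** * The vector space over F_4 carried by an AG-band *)

Lemma AG_medial (G : magmaType) (a b c d : G) :
  (forall x y z : G, ((x * y) * z = (z * y) * x)%g) ->
  ((a * b) * (c * d) = (a * c) * (b * d))%g.
Proof. by move=> linv; rewrite (linv a b) (linv c d b) (linv (b * d)%g). Qed.

(** With origin e, the scalars w and w^2 are x e and e x, and w (w^2 x) = x
    gives x = e (x e) = (e x) e.  If x y is to be w x + w^2 y, then the sum of
    x = w (w^2 x) and y = w^2 (w y) has to be (e x) (y e). *)
Lemma AG_band_affine (G : magmaType) : anti_rectangular_AG_band G ->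
  exists (V : zmodType) (phi : G -> V) (w : {additive V -> V}),
    [/\ bijective phi, forall v : V, (v + v = 0)%R,
        forall v : V, (w (w v) = w v + v)%R
      & forall x y : G, (phi (x * y)%g = w (phi x) + w (w (phi y)))%R].
Proof.
case=> -[e] linv idem antirect; pose add (x y : G) := ((e * x) * (y * e))%g.
have med a b c d := AG_medial G a b c d linv.
have sqr (x y : G) : ((y * x) * x = x * y)%g by rewrite linv -idem.
have antirect_l (x y : G) : (x * (y * x) = y)%g by rewrite -sqr (sqr x y) antirect.
have sqr_l (x : G) : (e * (e * x) = x * e)%g by rewrite -[LHS]sqr antirect.
have addC : commutative add by move=> x y; rewrite /add med.
have l_add u v : (e * add u v = (u * e) * v)%g.
  by rewrite /add [in LHS](idem e) med -!idem sqr_l antirect_l.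
have addAC x y z : add (add x y) z = add (add x z) y.
  by rewrite {1}/add l_add med -l_add.
have addA : associative add by move=> x y z; rewrite (addC x) addAC (addC y x).
have add0 : left_id e add by move=> x; rewrite /add -idem antirect_l.
have addN : left_inverse e id add.
  by move=> x; rewrite /add -(sqr e x) antirect.
(* A magma carries no choice structure, which a zmodType includes. *)
pose C : choiceType := HB.pack (G : Type) (gen_eqMixin G) (gen_choiceMixin G).
pose V : zmodType :=
  HB.pack (G : Type) C (GRing.isZmodule.Build C addA addC add0 addN).
pose r (x : V) : V := (x * e)%g.
have r_add : nmod_morphism r.
  split=> [|x y]; first by rewrite /r -[LHS]idem.
  by rewrite /r /GRing.add /= /add {3}(idem e) med antirect antirect_l.
pose w : {additive V -> V} := HB.pack r (GRing.isNmodMorphism.Build V V r r_add).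
have wE x : w x = (x * e)%g by [].
have w2E x : w (w x) = (e * x)%g by rewrite !wE sqr.
exists V, id, w; split => [||x|x y].
- by exists id.
- exact: addN.
- by rewrite w2E wE /GRing.add /= /add antirect_l -(sqr x (x * e)%g) antirect.
- by rewrite w2E wE /GRing.add /= /add antirect antirect_l.
Qed.

(** * Conjugation with respect to a real form *)

Section SemilinearBijection.

Context (V : zmodType) (w : {additive V -> V}).
Context (char2 : forall v : V, (v + v = 0)%R).
Context (w2 : forall v : V, (w (w v) = w v + v)%R).

Local Open Scope ring_scope.

Lemma char2_opp (v : V) : - v = v.
Proof. by apply/esym/eqP; rewrite -addr_eq0 char2. Qed.

Lemma char2_addKr (u v : V) : u + (u + v) = v.
Proof. by rewrite addrA char2 add0r. Qed.

Lemma char2_addrK (u v : V) : u + v + v = u.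
Proof. by rewrite -addrA char2 addr0. Qed.

Lemma w_cubed (v : V) : w (w (w v)) = v.
Proof. by rewrite !w2 addrAC char2 add0r. Qed.

(** In characteristic 2, closure under addition makes A a subgroup as soon as
    it is nonempty; the empty set is kept because it is the union of the empty
    chain. *)
Definition totally_real (A : set V) : Prop :=
  (forall u v, A u -> A v -> A (u + v)) /\ (forall u, A u -> A (w u) -> u = 0).

(** A totally real subgroup A can be enlarged by any x outside A + w A: if
    z = a + s x and w z = b + t x with a, b in A and s, t in F_2, then
    (t + s w) x = w a + b lies in the F_4-subspace A + w A, and t + s w is
    invertible in F_4 unless s = t = 0. *)
Lemma real_form_exists : exists A : set V,
  totally_real A /\ forall x, exists u v, [/\ A u, A v & x = u + w v].
Proof.
have [|A [[addA realA] maxA]] := @Zorn_bigcup V totally_real.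
  move=> F F_real F_total.
  split=> [u v [X FX Xu] [Y FY Yv]|u [X FX Xu] [Y FY Yv]].
    have [XY|YX] := F_total X Y FX FY.
      by exists Y => //; apply: (F_real Y FY).1 => //; exact: XY.
    by exists X => //; apply: (F_real X FX).1 => //; exact: YX.
  have [XY|YX] := F_total X Y FX FY.
    by apply: (F_real Y FY).2 => //; exact: XY.
  by apply: (F_real X FX).2 => //; exact: YX.
have A0 : A 0.
  have [[u Au]|A_empty] := pselect (exists u, A u).
    by rewrite -(char2 u); exact: addA.
  case: (maxA [set 0]).
    by split=> [u Au|/(_ 0 erefl) A0]; case: A_empty; [exists u|exists 0].
  by split=> [u v -> ->|u -> _ //]; rewrite /= addr0.
exists A; split=> // x; apply: contrapT => x_notin.
have {}x_notin u v : A u -> A v -> x = u + w v -> False.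
  by move=> Au Av xE; apply: x_notin; exists u, v.
(* In characteristic 2, z lies in x + A if and only if z + x lies in A. *)
apply: (maxA [set z | A z \/ A (z + x)]).
  split=> [z|/(_ x)]; first by left.
  rewrite /= char2 => /(_ (or_intror A0)) Ax.
  by apply: (x_notin x 0) => //; rewrite raddf0 addr0.
split=> [u v|z] /=.
  case=> Au [] Av.
  - by left; exact: addA.
  - by right; rewrite -addrA; exact: addA.
  - by right; rewrite addrAC; exact: addA.
  - by left; rewrite -(char2_addrK (u + v) x) -addrA addrACA; exact: addA.
case=> Az [] Awz.
- exact: realA.
- case: (x_notin (w z + x) z) => //.
  by rewrite addrAC char2 add0r.
- case: (x_notin (z + x + w z) (w z)) => //; first exact: addA.
  by rewrite (w2 z) addrA char2_addrK addrAC char2 add0r.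
- case: (x_notin (z + x) (z + x + (w z + x))) => //; first exact: addA.
  by rewrite addrACA char2 addr0 raddfD /= (w2 z) char2_addKr addrAC char2
     add0r.
Qed.

(** Writing x = re x + w (im x) over a real form, conjugation sends it to
    re x + w^2 (im x), which is x + im x. *)
Lemma frobenius_semilinear_bijection : exists c : V -> V,
  [/\ bijective c, {morph c : x y / x + y} & forall x, c (w x) = w (w (c x))].
Proof.
have [A [[addA realA] /choice[re /choice[im spanA]]]] := real_form_exists.
have reA x : A (re x) by case: (spanA x).
have imA x : A (im x) by case: (spanA x).
have decomp x : x = re x + w (im x) by case: (spanA x).
have imE x u v : A u -> A v -> x = u + w v -> im x = v.
  move=> Au Av; rewrite [LHS]decomp => eq_uv.
  apply/eqP; rewrite -subr_eq0 char2_opp; apply/eqP/realA; first exact: addA.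
  suff -> : w (im x + v) = re x + u by exact: addA.
  rewrite raddfD -[w (im x)](char2_addKr (re x)) eq_uv.
  by rewrite addrA char2_addrK.
have imD x y : im (x + y) = im x + im y.
  apply: (imE _ (re x + re y)); rewrite ?raddfD; [exact: addA|exact: addA|].
  by rewrite addrACA -!decomp.
have imW x : im (w x) = re x + im x.
  apply: (imE _ (im x)) => //; first exact: addA.
  by rewrite {1}(decomp x) !raddfD /= w2 addrA addrC.
have im_im x : im (im x) = 0.
  apply: (imE _ (im x)) => //; last by rewrite raddf0 addr0.
  by rewrite -(char2 (re x)); exact: addA.
have re_x x : re x = w (im x) + x.
  by rewrite [X in _ + X]decomp addrC char2_addrK.
pose c x := x + im x.
have cK : involutive c.
  by move=> x; rewrite /c imD im_im addr0 char2_addrK.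
exists c; split=> [|x y|x].
- exact: inv_bij.
- by rewrite /c imD addrACA.
- by rewrite /c imW (w2 (x + im x)) raddfD /= re_x !addrA.
Qed.

End SemilinearBijection.

Theorem corollary12 (R Rbar : magmaType)
    (hR : anti_rectangular_AG_band R)
    (hcard : finite_type R \/ denumerable R)
    (hRbar : groupoid Rbar)
    (hanti : anti_isomorphic R Rbar) :
  isomorphic R Rbar.
Proof.
have [V [phi [w [[psi phiK psiK] char2 w2 phiM]]]] := AG_band_affine R hR.
have [c [c_bij cD cW]] := frobenius_semilinear_bijection V w char2 w2.
have [f [f_bij fM]] := hanti.
have phi_bij : bijective phi by exists psi.
have psi_bij : bijective psi by exists phi.
pose g := f \o (psi \o c \o phi).
have gM : {morph g : x y / (x * y)%g}.
  move=> x y; rewrite /g /= -fM; congr f.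
  apply: (can_inj phiK); rewrite !phiM !psiK cD !cW.
  by rewrite (w_cubed V w char2 w2) addrC.
exists (HB.pack_for {multiplicative R -> Rbar} g
          (isMultiplicative.Build R Rbar g gM)).
exact: bij_comp f_bij (bij_comp (bij_comp psi_bij c_bij) phi_bij).
Qed.
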